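(* The following identity of maps $\mathbb{C}[\mathrm{Gr}_{k,n}]\to\mathbb{C}[\mathrm{Gr}_{k,n}]_1$ holds: $$\gamma^2\pi=\pi\sigma^{-k}.$$
   Context: Let $3\le k\le n-3$. For a $k$-subset $I$ of $\{1,\dots,n\}$, $[I]$ is the Plücker coordinate (minor of a complex $k\times n$ matrix with column set $I$ in increasing order); $\mathbb{C}[\mathrm{Gr}_{k,n}]$ is the algebra generated by all $[I]$. Let $\sigma(i)=i-1$ mod $n$ on $\{1,\dots,n\}$, acting elementwise on subsets, and $\varrho=\sigma^{-1}$. The automorphism of $\mathbb{C}[\mathrm{Gr}_{k,n}]$ with $[I]\mapsto[\sigma(I)]$ for all $I$ is also denoted $\sigma$. Let $\mathbf{i}=\{\sigma^{k-1}(i),\dots,\sigma(i),i\}$; the $[\mathbf{i}]$, $1\le i\le n$, are called coefficients. For $0\le i\le k-1$, $1\le j\le n-k$, or $(i,j)=(0,0)$, let $M_{k,n}(i,j)=\{1,\dots,i\}\cup\{i+j+1,\dots,j+k\}$, with $M_{k,n}(0,0)=\{1,\dots,k\}$. $\mathbb{C}[\mathrm{Gr}_{k,n}]$ is a cluster algebra (of geometric type, coefficients not inverted) with an initial seed whose extended cluster consists of all $[M_{k,n}(i,j)]$. The cluster $\mathbf{x}(\mathcal{R}_{k,n})$ consists of those with $1\le i\le k-1$, $1\le j\le n-k-1$, and the others are exactly the coefficients (frozen). Its quiver has arrows $(i+1,j)\to(i,j)$, $(i,j)\to(i,j+1)$, $(i,j+1)\to(i+1,j)$ whenever both vertices are in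 the range $0\le i\le k-1,\ 1\le j\le n-k$ and not both are frozen, together with $(0,0)\to(k-1,1)$. Let $Q(\mathcal{R}_{k,n})$ be the full subquiver on the non-frozen vertices. $\mathbb{C}[\mathrm{Gr}_{k,n}]_1$ is the cluster algebra (without coefficients) in $\mathbb{C}(\mathbf{x}(\mathcal{R}_{k,n}))$ with initial seed $(\mathbf{x}(\mathcal{R}_{k,n}),Q(\mathcal{R}_{k,n}))$, and $\pi:\mathbb{C}[\mathrm{Gr}_{k,n}]\to\mathbb{C}[\mathrm{Gr}_{k,n}]_1$ is the surjective ring homomorphism sending every coefficient to $1$ and each element of $\mathbf{x}(\mathcal{R}_{k,n})$ to itself. For $1\le i\le k-1$, $1\le j\le n-k-1$, let $\widetilde{M}_{k,n}(i,j)=\varrho^{k-i}(M_{k,n}(i,j))$. The elements $\pi([\widetilde{M}_{k,n}(i,j)])$ form the cluster of a seed of $\mathbb{C}[\mathrm{Gr}_{k,n}]_1$ whose quiver is identified with $Q(\mathcal{R}_{k,n})$ via $(i,j)\mapsto(k-i,j)$. Hence there is a ($\mathbb{C}$-algebra) automorphism $\gamma$ of $\mathbb{C}[\mathrm{Gr}_{k,n}]_1$ determined by $$\gamma(\pi([M_{k,n}(i,j)]))=\pi([\widetilde{M}_{k,n}(k-i,j)])\qquad(1\le i\le k-1,\ 1\le j\le n-k-1).$$ *)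

(* Defs.v *)
From HB Require Import structures.
From mathcomp Require Import all_boot all_order all_algebra.
From mathcomp Require Import boolp reals complex mpoly.

Set Implicit Arguments.
Unset Strict Implicit.
Unset Printing Implicit Defensive.

Import GRing.Theory.
Local Open Scope ring_scope.

(** * The subalgebra generated by a set *)

Section GeneratedAlgebra.
Variables (K : fieldType) (A : comAlgType K) (S : A -> Prop).

Inductive in_alg : A -> Prop :=
| in_alg_gen x of S x : in_alg x
| in_alg_cst c : in_alg c%:A
| in_alg_add x y of in_alg x & in_alg y : in_alg (x + y)
| in_alg_mul x y of in_alg x & in_alg y : in_alg (x * y).

Definition genalg : {pred A} := fun x => `[< in_alg x >].

Lemma genalg_subalg_closed : subalg_closed genalg.
Proof.
split.
- by apply/asboolP; rewrite -[1]scale1r; apply: in_alg_cst.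
- move=> c x y /asboolP hx /asboolP hy; apply/asboolP.
  rewrite -mulr_algl; apply: in_alg_add => //.
  by apply: in_alg_mul => //; apply: in_alg_cst.
- by move=> x y /asboolP hx /asboolP hy; apply/asboolP; apply: in_alg_mul.
Qed.

HB.instance Definition _ :=
  GRing.isSubalgClosed.Build K A genalg genalg_subalg_closed.

Record subalg := Subalg { subalg_val :> A; _ : subalg_val \in genalg }.

HB.instance Definition _ := [isSub for subalg_val].
HB.instance Definition _ := [Choice of subalg by <:].
HB.instance Definition _ := [SubChoice_isSubComNzRing of subalg by <:].
HB.instance Definition _ := [SubZmodule_isSubLmodule of subalg by <:].
HB.instance Definition _ := [SubNzRing_SubLmodule_isSubLalgebra of subalg by <:].
HB.instance Definition _ := [SubLalgebra_isSubAlgebra of subalg by <:].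

End GeneratedAlgebra.

(** * Rational functions as an algebra over the constants *)

Definition ratfun (K : fieldType) (N : nat) := {fraction {mpoly K[N]}}.

Section RationalFunctions.
Variables (K : fieldType) (N : nat).
Local Notation F := (ratfun K N).

HB.instance Definition _ := GRing.Field.on F.

Definition ratfun_of (p : {mpoly K[N]}) : F := tofrac p.

Definition ratfun_scale (c : K) (x : F) : F := ratfun_of c%:MP * x.

Fact ratfun_scaleA a b x :
  ratfun_scale a (ratfun_scale b x) = ratfun_scale (a * b) x.
Proof. by rewrite /ratfun_scale /ratfun_of mpolyCM tofracM mulrA. Qed.

Fact ratfun_scale1 : left_id 1 ratfun_scale.
Proof. by move=> x; rewrite /ratfun_scale /ratfun_of tofrac1 mul1r. Qed.

Fact ratfun_scaleDr : right_distributive ratfun_scale +%R.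
Proof. by move=> a x y; rewrite /ratfun_scale mulrDr. Qed.

Fact ratfun_scaleDl x : {morph ratfun_scale^~ x : a b / a + b}.
Proof. by move=> a b; rewrite /ratfun_scale /ratfun_of mpolyCD tofracD mulrDl. Qed.

HB.instance Definition _ := GRing.Zmodule_isLmodule.Build K F
  ratfun_scaleA ratfun_scale1 ratfun_scaleDr ratfun_scaleDl.

Fact ratfun_scaleAl (a : K) (x y : F) : a *: (x * y) = (a *: x) * y.
Proof. exact: mulrA. Qed.

HB.instance Definition _ := GRing.Lmodule_isLalgebra.Build K F ratfun_scaleAl.

Fact ratfun_scaleAr (a : K) (x y : F) : a *: (x * y) = x * (a *: y).
Proof. exact: mulrCA. Qed.

HB.instance Definition _ := GRing.Lalgebra_isAlgebra.Build K F ratfun_scaleAr.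

End RationalFunctions.

(** * Cluster algebras without coefficients *)

Section Cluster.
Variables (V : finType) (F : fieldType).

(* [quiver_arrows s v w] is the number of arrows v -> w. *)
Record seed := Seed {
  cluster : V -> F;
  quiver_arrows : V -> V -> nat
}.

(* For each path i -> v -> j an arrow i -> j is added, and the arrows at v are
   reversed; the truncated subtraction in [quiver_mutation] then cancels
   2-cycles. *)
Definition quiver_premutation (v : V) (q : V -> V -> nat) (i j : V) : nat :=
  if (i == v) || (j == v) then q j i else (q i j + q i v * q v j)%N.

Definition quiver_mutation (v : V) (q : V -> V -> nat) (i j : V) : nat :=
  (quiver_premutation v q i j - quiver_premutation v q j i)%N.

Definition cluster_mutation (v : V) (s : seed) (w : V) : F :=
  let q := quiver_arrows s in
  let x := cluster s in
  if w == v then (\prod_i x i ^+ q i v + \prod_i x i ^+ q v i) / x v else x w.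

Definition mutation (v : V) (s : seed) : seed :=
  Seed (cluster_mutation v s) (quiver_mutation v (quiver_arrows s)).

Inductive mutation_equiv (s : seed) : seed -> Prop :=
| mutation_refl : mutation_equiv s s
| mutation_step t v of mutation_equiv s t : mutation_equiv s (mutation v t).

Definition cluster_variable (s : seed) (x : F) : Prop :=
  exists t v, mutation_equiv s t /\ x = cluster t v.

End Cluster.

(** * The homogeneous coordinate ring of the Grassmannian

    The label i in {1, ..., n} is the ordinal i - 1 of 'I_n, so that sigma
    (i |-> i - 1 mod n) is [ord_pred] and rho = sigma^-1 is [ordS]. *)

Section Grassmannian.
Variables (K : fieldType) (k n : nat).

Definition generic_entry (a : 'I_k) (j : 'I_n) : {mpoly K[k * n]} :=
  'X_(mxvec_index a j).

(* [enum I] is increasing, and the default value of [nth] is never reached.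
   By convention [I] = 0 when I is not a k-subset. *)
Definition plucker_poly (I : {set 'I_n}) : {mpoly K[k * n]} :=
  if #|I| == k then
    \det (\matrix_(a < k, b < k) nth 0 [seq generic_entry a j | j <- enum I] b)
  else 0.

Definition is_plucker (p : {mpoly K[k * n]}) : Prop :=
  exists I : {set 'I_n}, #|I| = k /\ p = plucker_poly I.

Definition Gr := subalg is_plucker.

Fact plucker_subproof (I : {set 'I_n}) : plucker_poly I \in genalg is_plucker.
Proof.
have [hI|hI] := eqVneq #|I| k; last by rewrite /plucker_poly (negbTE hI) rpred0.
by apply/asboolP/in_alg_gen; exists I.
Qed.

Definition plucker (I : {set 'I_n}) : Gr := Subalg (plucker_subproof I).

Definition sigma_set (m : nat) (I : {set 'I_n}) : {set 'I_n} :=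
  [set iter m (@ord_pred n) x | x in I].

Definition rho_set (m : nat) (I : {set 'I_n}) : {set 'I_n} :=
  [set iter m (@ordS n) x | x in I].

Definition coef_set (i : 'I_n) : {set 'I_n} :=
  [set iter m (@ord_pred n) i | m : 'I_k].

Definition M_set (i j : nat) : {set 'I_n} :=
  [set x : 'I_n | (x < i)%N || (i + j <= x < j + k)%N].

Definition Mtilde_set (i j : nat) : {set 'I_n} := rho_set (k - i) (M_set i j).

(** ** The initial quiver *)

Definition in_range (p : nat * nat) : bool :=
  (p.1 <= k.-1)%N && (1 <= p.2 <= n - k)%N.

Definition frozen (p : nat * nat) : bool := (p.1 == 0)%N || (p.2 == n - k)%N.

Definition arrow (p q : nat * nat) : bool :=
  [&& in_range p, in_range q, ~~ (frozen p && frozen q) &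
    [|| p == (q.1.+1, q.2), q == (p.1, p.2.+1)
      | (p.2 == q.2.+1)%N && (q.1 == p.1.+1)%N]]
  || (p == (0, 0)%N) && (q == (k.-1, 1)%N).

(* The ordinals a and b stand for the vertex (a + 1, b + 1), so that this is
   the set of pairs (i, j) with 1 <= i <= k - 1 and 1 <= j <= n - k - 1. *)
Definition mutable : finType := ('I_(k - 1) * 'I_(n - k - 1))%type.

Definition label (v : mutable) : nat * nat := ((v.1 : nat).+1, (v.2 : nat).+1).

Definition initial_seed : seed mutable (ratfun K (k * n)) :=
  Seed (fun v => ratfun_of (plucker_poly (M_set (label v).1 (label v).2)))
       (fun v w => arrow (label v) (label w) : nat).

(* The ambient field contains both the algebra [Gr] and the field generated by
   the initial cluster, in which all the cluster variables lie. *)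
Definition Gr1 := subalg (cluster_variable initial_seed).

(** ** The maps sigma, pi and gamma *)

Definition is_sigma (sigma : {lrmorphism Gr -> Gr}) : Prop :=
  bijective sigma /\
  forall I : {set 'I_n}, #|I| = k ->
    sigma (plucker I) = plucker (sigma_set 1 I).

Definition is_pi (pi : {lrmorphism Gr -> Gr1}) : Prop :=
  [/\ forall y : Gr1, exists x : Gr, pi x = y,
      forall i : 'I_n, pi (plucker (coef_set i)) = 1
    & forall i j : nat, (1 <= i <= k - 1)%N -> (1 <= j <= n - k - 1)%N ->
        subalg_val (pi (plucker (M_set i j))) =
        ratfun_of (subalg_val (plucker (M_set i j)))].

Definition is_gamma (pi : {lrmorphism Gr -> Gr1})
    (gamma : {lrmorphism Gr1 -> Gr1}) : Prop :=
  bijective gamma /\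
  forall i j : nat, (1 <= i <= k - 1)%N -> (1 <= j <= n - k - 1)%N ->
    gamma (pi (plucker (M_set i j))) = pi (plucker (Mtilde_set (k - i) j)).

End Grassmannian.

(* Main.v *)
Require Import Defs.
From HB Require Import structures.
From mathcomp Require Import all_boot all_order all_fingroup all_algebra.
From mathcomp Require Import boolp reals complex mpoly.
From mathcomp Require Import zify ring.

(** The automorphism [gamma] is a twist of the Grassmannian, and the square of
    the twist is the cyclic shift by [k].

    Since [pi] sends the coefficients to 1, it takes the Plucker coordinates to
    the minors of a matrix with columns [v_0, ..., v_{n-1}], which is extended
    to a family indexed by all naturals with [v_{m+n} = (-1)^(k-1) v_m]; then
    all the minors [det(v_c, ..., v_{c+k-1})] are 1, and the minor at any
    increasing sequence spanning less than [n] is the value of [pi] at the set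
    of its residues ([minor_frame]).

    Let [v'_i] be the functional [w |-> det(w, v_{i+1}, ..., v_{i+k-1})]. For
    [p + q = k], the minor of [v'] on two runs of [p] and [q] consecutive
    indices starting at [a] and [b] is the minor of [v] on the runs of [q] and
    [p] indices starting at [a + p] and [b + q] ([twist_two_runs]). Applied to
    [M(i, j)], this gives [rho^i M(k - i, j)], which is the set that defines
    [gamma (pi [M(i, j)])]; applied once more, it gives [rho^k M(i, j)].

    The values on the initial extended cluster only matter because they
    determine all the minors: two families whose minors on this cluster agree
    and are nonzero differ by a matrix of determinant 1 ([minors_determine]).
    A first use identifies [gamma pi] with the twist ([frame2_twist]), which
    yields the values of [gamma pi] at the sets [rho^i M(k - i, j)], that is,
    those of [gamma^2 pi] at [M(i, j)]; a second use compares [gamma^2 pi] with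
    [pi rho^k] ([phi3_shift]). *)

Set Implicit Arguments.
Unset Strict Implicit.
Unset Printing Implicit Defensive.

Import GRing.Theory.
Local Open Scope ring_scope.

(** * Determinants and minors *)

Section Det.
Variable R : comNzRingType.

(** Entries indexed by natural numbers, so that sizes can be split and commuted
    without casts. *)
Definition ndet k (M : nat -> nat -> R) : R := \det (\matrix_(a < k, b < k) M a b).

Lemma ndet_block p q M :
  (forall a b, (a < p)%N -> (p <= b < p + q)%N -> M a b = 0) ->
  ndet (p + q) M = ndet p M * ndet q (fun a b => M (p + a)%N (p + b)%N).
Proof.
move=> hM; rewrite /ndet; set A := \matrix_(_, _) _.
have ur0 : ursubmx A = 0.
  by apply/matrixP=> a b; rewrite !mxE hM //= leq_addr ltn_add2l /=.
rewrite -[A]submxK ur0 det_lblock.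
by congr (_ * _); congr (\det _); apply/matrixP=> a b; rewrite !mxE.
Qed.

Lemma ndet_unitrig k M :
  (forall a b, (a < b < k)%N -> M a b = 0) ->
  (forall a, (a < k)%N -> M a a = 1) -> ndet k M = 1.
Proof.
move=> h0 h1; rewrite /ndet det_trig.
  by rewrite big1 // => i _; rewrite mxE h1.
by apply/is_trig_mxP => i j lij; rewrite mxE h0 // lij /=.
Qed.

(** Linearity in one column, in the form used throughout: a determinant is a
    linear functional of the column [j], with coefficients that do not involve
    this column. *)
Lemma det_replace_col k (M : 'M[R]_k) j (w : 'I_k -> R) :
  \det (\matrix_(a, b) if b == j then w a else M a b) =
  \sum_a w a * cofactor M a j.
Proof.
rewrite (expand_det_col _ j); apply: eq_bigr => a _; rewrite mxE eqxx.
congr (_ * (_ * \det _)); apply/matrixP => c b.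
by rewrite !mxE eq_sym (negbTE (neq_lift _ _)).
Qed.

Lemma det_repeated_col k (M : 'M[R]_k) b1 b2 :
  b1 != b2 -> (forall a, M a b1 = M a b2) -> \det M = 0.
Proof.
move=> nb hb; rewrite -det_tr (@determinant_alternate _ _ _ b1 b2) // => a.
by rewrite !mxE.
Qed.

Section Minors.
Variable k : nat.
Implicit Types (v u : nat -> 'cV[R]_k) (s t : nat -> nat).

(** Plucker coordinates of an infinite family of column vectors; only the first
    [k] values of [s] matter. *)
Definition minor v s : R := \det (\matrix_(a < k, b < k) v (s b) a 0).

Lemma eq_minor v u s t :
  (forall b, (b < k)%N -> v (s b) = u (t b)) -> minor v s = minor u t.
Proof.
by move=> h; congr (\det _); apply/matrixP => a b; rewrite !mxE h.
Qed.

Lemma minor_mull (g : 'M_k) v s :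
  minor (fun m => g *m v m) s = \det g * minor v s.
Proof.
rewrite -det_mulmx; congr (\det _); apply/matrixP => a b; rewrite !mxE.
by apply: eq_bigr => i _; rewrite !mxE.
Qed.

Lemma minor_perm v s (p : 'S_k) :
  \det (\matrix_(a, b) v (s (p b)) a 0) = (-1) ^+ p * minor v s.
Proof.
have -> : \matrix_(a, b) v (s (p b)) a 0 = col_perm p (\matrix_(a, b) v (s b) a 0).
  by apply/matrixP => a b; rewrite !mxE.
by rewrite col_permE det_mulmx det_perm odd_permV mulrC.
Qed.

Definition pairing (x y : 'cV[R]_k) : R := \sum_a x a 0 * y a 0.

(** Cauchy-Binet for square matrices: this is how minors of a twisted family are
    compared with minors of the original one. *)
Lemma minor_pairing u v s t :
  minor u s * minor v t = ndet k (fun a b => pairing (u (s a)) (v (t b))).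
Proof.
rewrite /minor -[X in X * _]det_tr -det_mulmx; congr (\det _).
by apply/matrixP => a b; rewrite !mxE; apply: eq_bigr => c _; rewrite !mxE.
Qed.

End Minors.

(** * The twist *)

Section Twist.
Variable k' : nat.
Local Notation k := k'.+1.
Implicit Types v : nat -> 'cV[R]_k.

(** The covector of [w |-> det(w, v_{i+1}, ..., v_{i+k-1})], that is, the
    Marsh-Scott twist up to sign and direction. *)
Definition twist v (i : nat) : 'cV[R]_k :=
  \col_a cofactor (\matrix_(c, b) v (i + b)%N c 0) a ord0.

Lemma pairing_twist v i (w : 'cV_k) :
  pairing (twist v i) w =
  \det (\matrix_(a, b < k) if b == ord0 then w a 0 else v (i + b)%N a 0).
Proof.
pose M := \matrix_(c, b < k) v (i + b)%N c 0.
have := det_replace_col M ord0 (fun a => w a 0).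
rewrite (_ : \matrix_(a, b) (if b == ord0 then _ else _) =
   \matrix_(a, b) if b == ord0 then w a 0 else v (i + b)%N a 0).
  by move=> ->; apply: eq_bigr => a _; rewrite !mxE mulrC.
by apply/matrixP => a b; rewrite !mxE.
Qed.

Lemma pairing_twist0 v i j : (i < j < i + k)%N -> pairing (twist v i) (v j) = 0.
Proof.
move=> /andP[ij jk]; rewrite pairing_twist.
have hj : (j - i < k)%N by lia.
apply: (@det_repeated_col _ _ ord0 (Ordinal hj)) => [|a].
  by rewrite -val_eqE /=; lia.
by rewrite !mxE eqxx -val_eqE /= ifN; [rewrite subnKC //; lia | lia].
Qed.

Hypothesis (v : nat -> 'cV[R]_k) (hv : forall i, minor v (addn i) = 1).

Lemma pairing_twist1 i : pairing (twist v i) (v i) = 1.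
Proof.
rewrite pairing_twist -[RHS](hv i); congr (\det _); apply/matrixP => a b.
by rewrite !mxE; case: eqP => // ->; rewrite addn0.
Qed.

Lemma twist_consecutive i : minor (twist v) (addn i) = 1.
Proof.
rewrite -[LHS]mulr1 -[X in _ * X](hv i) minor_pairing; apply: ndet_unitrig => [a b|a] h.
  by apply: pairing_twist0; lia.
exact: pairing_twist1.
Qed.

Definition two_runs (a p b t : nat) : nat := if (t < p)%N then (a + t)%N else (b + (t - p))%N.

(** Both sides equal the determinant [C] of the [q * q] pairings between the
    second run of twisted vectors and [v_{a+p}, ..., v_{a+k-1}]: multiply the
    left-hand side by the minor [v_a, ..., v_{a+k-1}], and the right-hand side
    by the twisted minor of [b, ..., b+k-1], both equal to 1. The matrices of
    pairings so obtained are block triangular, with one diagonal block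
    unitriangular because [twist v i] kills [v_{i+1}, ..., v_{i+k-1}] and takes
    the value 1 on [v_i]. *)
Lemma twist_two_runs p q a b : (p + q = k)%N ->
  minor (twist v) (two_runs a p b) = minor v (two_runs (a + p) q (b + q)).
Proof.
move=> hpq; pose C := ndet q (fun s t => pairing (twist v (b + s)) (v (a + p + t)%N)).
transitivity C.
- rewrite -[LHS]mulr1 -[X in _ * X](hv a) minor_pairing.
  set M := fun _ _ => _; rewrite (_ : ndet k M = ndet (p + q) M); last by rewrite hpq.
  rewrite ndet_block => [|s t hs ht]; last first.
    by rewrite /M /two_runs hs; apply: pairing_twist0; lia.
  rewrite ndet_unitrig ?mul1r => [|s t h|s h].
  + congr (\det _); apply/matrixP => s t; rewrite !mxE /M /two_runs ifN; last by lia.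
    by congr (pairing (twist v _) (v _)); lia.
  + by rewrite /M /two_runs ifT; [apply: pairing_twist0; lia | lia].
  + by rewrite /M /two_runs h pairing_twist1.
- apply/esym; rewrite -[LHS]mul1r -[X in X * _](twist_consecutive b) minor_pairing.
  set M := fun _ _ => _; rewrite (_ : ndet k M = ndet (q + p) M); last by rewrite -hpq addnC.
  rewrite ndet_block => [|s t hs ht]; last first.
    by rewrite /M /two_runs ifN; [apply: pairing_twist0; lia | lia].
  rewrite [X in _ * X]ndet_unitrig ?mulr1 => [|s t h|s h].
  + congr (\det _); apply/matrixP => s t; rewrite !mxE /M /two_runs ifT; last by [].
    by congr (pairing (twist v _) (v _)); lia.
  + by rewrite /M /two_runs ifN; [apply: pairing_twist0; lia | lia].
  + rewrite /M /two_runs ifN; last by lia.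
    by rewrite (_ : b + q + (q + s - q) = b + (q + s))%N ?pairing_twist1 //; lia.
Qed.

(** The sign is unchanged since [(k - 1)^2] and [k - 1] have the same parity. *)
Lemma twist_periodic n :
  (forall m, v (m + n)%N = (-1) ^+ k' *: v m) ->
  forall m, twist v (m + n)%N = (-1) ^+ k' *: twist v m.
Proof.
move=> hn m; apply/matrixP => a c; rewrite !mxE /cofactor mulrCA; congr (_ * _).
have -> : row' a (col' ord0 (\matrix_(c0, b < k) v (m + n + b)%N c0 0)) =
   (-1) ^+ k' *: row' a (col' ord0 (\matrix_(c0, b < k) v (m + b)%N c0 0)).
  by apply/matrixP => x y; rewrite !mxE addnAC hn mxE.
by rewrite detZ -exprM -[in LHS]signr_odd oddM /= andbb signr_odd.
Qed.
End Twist.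

End Det.

(** * Reconstruction from the minors of the initial seed *)

Section Uniqueness.
Variables (F : fieldType) (k' : nat).
Local Notation k := k'.+1.
Implicit Types v u : nat -> 'cV[F]_k.

(** With labels shifted to start at 0, [skip i j] enumerates [M_{k,n}(i,j)]:
    the first [i] indices, then a gap of length [j]. *)
Definition skip (i j t : nat) : nat := if (t < i)%N then t else (t + j)%N.

Lemma minor_skip0 v j : minor v (skip 0 j) = minor v (addn j).
Proof. by apply: eq_minor => b _; rewrite /skip addnC. Qed.

(** Replacing the last index [j + k] of [M(i, j + 1)] by the index [i] yields
    [M(i + 1, j)], up to the position of [i]. *)
Lemma skip_bump i j t : skip i j.+1 t = skip i.+1 j (bump i t).
Proof.
rewrite /skip /bump; case: leqP => h; last by rewrite add0n ltnS (ltnW h).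
by rewrite add1n ltnS ltnNge h /= addSnnS.
Qed.

(** Expand [d] on the basis [u_0, ..., u_{k-1}] with coordinates [c]. In the
    [i]-th functional the terms [c_l u_l] with [l < i] repeat a column, so the
    system is triangular in [c], and its [i]-th diagonal coefficient is, up to
    sign, the minor at [skip i.+1 j] by [skip_bump]. *)
Lemma skip_functionals_inj u j (d : 'cV[F]_k) :
  minor u id != 0 ->
  (forall i, (i < k)%N -> minor u (skip i.+1 j) != 0) ->
  (forall i, (i < k)%N ->
     \det (\matrix_(a, b < k) if b == ord_max then d a 0 else u (skip i j.+1 b) a 0) = 0) ->
  d = 0.
Proof.
move=> hU hs hd.
pose U := \matrix_(a, b < k) u b a 0.
have uU : U \in unitmx by rewrite unitmxE unitfE.
have [c dE] : exists c, d = U *m c by exists (invmx U *m d); rewrite mulKVmx.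
suff c0 r : (r <= k)%N -> forall l : 'I_k, (k - r <= l)%N -> c l 0 = 0.
  rewrite dE; apply/matrixP => a b; rewrite ord1 !mxE big1 // => l _.
  by rewrite (c0 k) ?mulr0 // subnn.
(* Downwards induction on the index: the last [r] coordinates vanish. *)
elim: r => [|r IH] hr l hl; first by have := ltn_ord l; lia.
have [|ll] := leqP (k - r) l; first by apply: IH; lia.
pose M := \matrix_(a, b < k) u (skip l j.+1 b) a 0.
have rep w : \det (\matrix_(a, b < k) if b == ord_max then w a else u (skip l j.+1 b) a 0)
   = \sum_a w a * cofactor M a ord_max.
  rewrite -det_replace_col; congr (\det _); apply/matrixP => a b; rewrite !mxE.
  by case: ifP.
have := hd l (ltn_ord l); rewrite rep.
have -> : \sum_a d a 0 * cofactor M a ord_max =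
   \sum_m c m 0 * \det (\matrix_(a, b < k) if b == ord_max then u m a 0 else u (skip l j.+1 b) a 0).
  under [RHS]eq_bigr => m _ do rewrite rep mulr_sumr.
  rewrite exchange_big /=; apply: eq_bigr => a _.
  rewrite dE mxE mulr_suml; apply: eq_bigr => m _; rewrite !mxE; ring.
rewrite (bigD1 l) //= big1 => [|m ml].
  rewrite addr0 => /eqP; rewrite mulf_eq0 => /orP[/eqP //|].
  have -> : \matrix_(a, b < k) (if b == ord_max then u l a 0 else u (skip l j.+1 b) a 0)
     = \matrix_(a, b < k) u (skip l.+1 j (lift_perm ord_max l 1%g b)) a 0.
    apply/matrixP => a b; rewrite !mxE.
    case: (unliftP ord_max b) => [b'|] ->.
      rewrite lift_perm_lift perm1 eq_sym (negbTE (neq_lift _ _)).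
      by rewrite lift_max skip_bump.
    by rewrite eqxx lift_perm_id /skip ltnSn.
  by rewrite minor_perm mulf_eq0 signr_eq0 (negbTE (hs l _)).
have [lm|lm] := ltnP l m; first by rewrite IH ?mul0r //; lia.
have ltm : (m < l)%N by move: ml; rewrite -val_eqE /=; lia.
rewrite (@det_repeated_col _ _ _ m ord_max) ?mulr0 // => [|a].
  by rewrite -val_eqE /=; have := ltn_ord l; lia.
rewrite !mxE eqxx ifN /skip ?ltm //.
by rewrite -val_eqE /=; have := ltn_ord l; lia.
Qed.

(** The minors at the initial seed are coordinates on the Grassmannian: a change
    of basis makes the first [k] columns agree, and then each further column
    [m = j + k - 1] is determined by the preceding ones and by the minors
    [skip i j], by [skip_functionals_inj]. *)
Lemma minors_determine n v u :
  (k <= n)%N -> minor v id = minor u id -> minor u id != 0 ->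
  (forall i j, (i < k)%N -> (0 < j <= n - k)%N ->
     minor v (skip i j) = minor u (skip i j) /\ minor u (skip i j) != 0) ->
  exists g : 'M[F]_k, \det g = 1 /\ forall m, (m < n)%N -> u m = g *m v m.
Proof.
move=> kn huv hu hsk.
pose V := \matrix_(a, b < k) v b a 0; pose U := \matrix_(a, b < k) u b a 0.
have uV : V \in unitmx by rewrite unitmxE unitfE -/(minor v id) huv.
exists (U *m invmx V); set g := _ *m _.
have dg : \det g = 1.
  by rewrite det_mulmx det_inv -/(minor u id) -/(minor v id) huv divff.
split=> //; elim/ltn_ind => m IH mn.
have [mk|mk] := ltnP m k.
  have /matrixP h : g *m V = U by rewrite mulmxKV.
  apply/matrixP => a c; rewrite ord1; have := h a (Ordinal mk).
  by rewrite !mxE /= => <-; apply: eq_bigr => b _; rewrite !mxE.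
have [j jE] : exists j, m = (k' + j.+1)%N by exists (m - k')%N.-1; lia.
apply/subr0_eq; apply: (@skip_functionals_inj u j) => // i ik.
(* The diagonal coefficients are minors with gap [j], nonzero by hypothesis,
   except in the two cases where the index set is [0, k). *)
- have [->|ik'] := eqVneq i k'.
    rewrite (@eq_minor _ _ _ u _ id) // => b hb.
    by rewrite /skip hb.
  case: j jE => [|j] jE.
    by rewrite (@eq_minor _ _ _ u _ id) // => b hb; rewrite /skip addn0 if_same.
  by apply: (hsk i.+1 j.+1 _ _).2; lia.
- pose M := \matrix_(a, b < k) u (skip i j.+1 b) a 0.
  have rep (w : nat -> 'cV[F]_k) : (forall b, (b < k')%N -> w (skip i j.+1 b) = u (skip i j.+1 b)) ->
     minor w (skip i j.+1) = \sum_a w m a 0 * cofactor M a ord_max.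
    move=> hw; rewrite -det_replace_col; congr (\det _); apply/matrixP => a b; rewrite !mxE.
    case: eqP => [->|/eqP hb].
      by congr (w _ _ _); rewrite /skip jE /= ifN //; lia.
    by rewrite hw //; move: hb (ltn_ord b); rewrite -val_eqE /=; lia.
  have -> : \matrix_(a, b < k) (if b == ord_max then (u m - g *m v m) a 0 else u (skip i j.+1 b) a 0)
    = \matrix_(a, b < k) (if b == ord_max then (u m - g *m v m) a 0 else M a b).
    by apply/matrixP => a b; rewrite !mxE.
  rewrite (det_replace_col _ _ (fun a => (u m - g *m v m) a 0)).
  under eq_bigr => a _ do rewrite mxE [X in _ + X]mxE mulrBl.
  rewrite sumrB -(rep u) // -(rep (fun m => g *m v m)) => [|b hb].
    by rewrite minor_mull dg mul1r (hsk i j.+1 _ _).1 ?subrr //; lia.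
  by rewrite IH //; rewrite /skip; case: ifP; lia.
Qed.
End Uniqueness.

(** * Cyclic index sets *)

Section Index.
Variables (k' n' : nat).
Local Notation k := k'.+1.
Local Notation n := n'.+1.
Implicit Type s : nat -> nat.

(** Columns are indexed by natural numbers read modulo [n], so that a cyclic
    interval is an honest interval and [rho] is a translation. *)
Definition residue (m : nat) : 'I_n := inord (m %% n).

Lemma val_residue m : residue m = (m %% n)%N :> nat.
Proof. by rewrite inordK // ltn_mod. Qed.

Lemma residueE (i : 'I_n) m : (m %% n = i)%N -> residue m = i.
Proof. by move=> h; apply/val_inj; rewrite /= val_residue. Qed.

Lemma residue_ord (i : 'I_n) : residue i = i.
Proof. by apply: residueE; rewrite modn_small. Qed.

Lemma residueDn m : residue (m + n) = residue m.
Proof. by apply: residueE; rewrite modnDr val_residue. Qed.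

Lemma residueBn m : (n <= m)%N -> residue (m - n) = residue m.
Proof. by move=> h; rewrite -[in RHS](subnK h) residueDn. Qed.

Definition residues s : {set 'I_n} := [set residue (s t) | t : 'I_k].

Lemma eq_residues s (t : nat -> nat) : (forall b, (b < k)%N -> s b = t b) -> residues s = residues t.
Proof. by move=> h; apply: eq_imset => b; rewrite h. Qed.

Definition increasing s := forall a b, (a < b < k)%N -> (s a < s b)%N.

Lemma sorted_enum_ord (I : {set 'I_n}) : sorted ltn (map val (enum I)).
Proof.
rewrite sorted_map /enum_mem -enumT; apply: sorted_filter.
  by move=> ? ? ?; apply: ltn_trans.
by rewrite -sorted_map val_enum_ord iota_ltn_sorted.
Qed.

Lemma enum_residues s : increasing s -> (s k' < n)%N ->
  enum (residues s) = [seq residue (s b) | b <- iota 0 k].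
Proof.
move=> hs hn.
have sn b : (b < k)%N -> (s b < n)%N.
  rewrite ltnS leq_eqVlt => /orP[/eqP-> //|h]; apply: ltn_trans hn; apply: hs; lia.
apply: (inj_map val_inj).
apply: (irr_sorted_eq ltn_trans ltnn).
- exact: sorted_enum_ord.
- rewrite -map_comp (@eq_in_map _ _ _ s _).1; last first.
    by move=> b; rewrite mem_iota => /andP[_ hb]; rewrite /= val_residue modn_small // sn.
  rewrite sorted_map; apply/(sortedP 0) => i; rewrite size_iota => hi.
  by rewrite !nth_iota //; [apply: hs; lia | lia].
- move=> x; apply/mapP/mapP => -[y].
    rewrite mem_enum => /imsetP[t _ ->] ->; exists (residue (s t)) => //.
    by apply/mapP; exists (t : nat) => //; rewrite mem_iota /=.
  case/mapP=> b; rewrite mem_iota => /andP[_ hb] -> ->; exists (residue (s b)) => //.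
  by rewrite mem_enum; apply/imsetP; exists (Ordinal hb).
Qed.

Lemma card_residues s : increasing s -> (s k' < n)%N -> #|residues s| = k.
Proof. by move=> hs hn; rewrite cardE enum_residues // size_map size_iota. Qed.

Lemma residuesP (I : {set 'I_n}) : #|I| = k ->
  exists s, [/\ increasing s, (s k' < n)%N & I = residues s].
Proof.
move=> hI; pose s b := nth ord0 (enum I) b : nat.
have hz : size (enum I) = k by rewrite -cardE.
exists s; split=> [a b /andP[ab bk]||]; last 1 first.
- apply/setP => x; apply/idP/imsetP => [xI|[t _ ->]].
    have hx : (index x (enum I) < k)%N by rewrite -hz index_mem mem_enum.
    by exists (Ordinal hx) => //; rewrite residue_ord nth_index ?mem_enum.
  by rewrite residue_ord -mem_enum mem_nth // hz.
- have := sorted_enum_ord I => /(sorted_ltn_nth ltn_trans 0%N) => /(_ a b).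
  rewrite !inE size_map hz !(nth_map ord0) ?hz //; last by lia.
  by apply=> //; lia.
- exact: ltn_ord.
Qed.

Lemma iter_ordS m (i : 'I_n) : iter m (@ordS n) i = residue (m + i).
Proof.
elim: m => [|m IH]; first by rewrite residue_ord.
by apply/val_inj; rewrite iterS IH /= !val_residue -addn1 modnDml addn1.
Qed.

Lemma iter_ord_pred m c : iter m (@ord_pred n) (residue (c + m)) = residue c.
Proof.
elim: m c => [|m IH] c; first by rewrite addn0.
rewrite iterS addnS -addSn IH; apply: (@ordS_inj n); rewrite ord_predK.
by apply/val_inj; rewrite /= !val_residue -addn1 -[in RHS]addn1 modnDml.
Qed.

Lemma rho_residues m s : rho_set m (residues s) = residues (fun t => (m + s t)%N).
Proof.
rewrite /rho_set /residues -imset_comp; apply: eq_imset => t /=.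
by rewrite iter_ordS; apply: val_inj => /=; rewrite !val_residue modnDmr.
Qed.

Lemma sigma_rho (I : {set 'I_n}) : sigma_set 1 (rho_set 1 I) = I.
Proof.
rewrite /sigma_set /rho_set -imset_comp -[RHS]imset_id; apply: eq_imset => x /=.
exact: ordSK.
Qed.

Lemma rho_setS m (I : {set 'I_n}) : rho_set m.+1 I = rho_set 1 (rho_set m I).
Proof. by rewrite /rho_set -imset_comp; apply: eq_imset. Qed.

Lemma rho_set0 (I : {set 'I_n}) : rho_set 0 I = I.
Proof. by rewrite /rho_set -[RHS]imset_id; apply: eq_imset. Qed.

Lemma card_rho m (I : {set 'I_n}) : #|rho_set m I| = #|I|.
Proof.
elim: m => [|m IH]; first by rewrite rho_set0.
by rewrite rho_setS card_imset //; apply: ordS_inj.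
Qed.

Lemma coef_residues c : coef_set k (residue (c + k')) = residues (addn c).
Proof.
apply/setP => x; apply/imsetP/imsetP => -[t _ ->]; exists (rev_ord t) => //.
  rewrite -[RHS](iter_ord_pred t); congr (iter _ _ (residue _)) => /=.
  by have := ltn_ord t; lia.
rewrite -[LHS](iter_ord_pred (rev_ord t)); congr (iter _ _ (residue _)) => /=.
by have := ltn_ord t; lia.
Qed.

Lemma M_residues i j : (i <= k)%N -> (j + k <= n)%N ->
  M_set k n i j = residues (skip i j).
Proof.
move=> ik jk; apply/setP => x; rewrite inE; apply/idP/imsetP.
  move=> h; have hx : ((if (x < i)%N then x : nat else x - j) < k)%N.
    by case: ltnP h => /= h; lia.
  exists (Ordinal hx) => //; rewrite -[LHS]residue_ord; congr residue.
  rewrite /skip /=.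
  by case: (ltnP x i) h => /= h1 h2; [rewrite h1 | rewrite ifN; lia].
case=> t _ ->; rewrite val_residue modn_small /skip; last first.
  by have := ltn_ord t; case: ifP; lia.
by case: (ltnP (t : nat) i) => h /=; [rewrite h | have := ltn_ord t; lia].
Qed.

(** The frozen vertices with [j = n - k] wrap around the end of the cycle. *)
Lemma skip_top_residues i : (i <= k)%N -> (k <= n)%N ->
  residues (skip i (n - k)) = residues (addn (n - k + i)).
Proof.
move=> ik kn; apply/setP => x; apply/imsetP/imsetP => -[t _ ->].
  have ht : ((if (t < i)%N then k - i + t else t - i) < k)%N.
    by have := ltn_ord t; case: ifP; lia.
  exists (Ordinal ht) => //; rewrite /skip /=; case: (ltnP (t : nat) i) => h.
    by rewrite -residueDn; congr residue; lia.
  by congr residue; lia.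
have ht : ((if (t < k - i)%N then i + t else t - (k - i)) < k)%N.
  by have := ltn_ord t; case: ifP; lia.
exists (Ordinal ht) => //; rewrite /skip /=; case: (ltnP (t : nat) (k - i)) => h.
  by rewrite ifN; [congr residue|]; lia.
rewrite ifT; last by have := ltn_ord t; lia.
by rewrite -[RHS]residueDn; congr residue; lia.
Qed.

(** When the last term of a sequence is at least [n], subtracting [n] from it
    and moving it to the front keeps its residues; iterating this reduces an
    increasing sequence spanning less than [n] to one with all terms below
    [n]. *)
Lemma residues_rotate s : (n <= s k')%N ->
  residues (fun t => if t is t'.+1 then s t' else (s k' - n)%N) = residues s.
Proof.
move=> hn; apply/setP => x; apply/imsetP/imsetP => -[t _ ->].
  case: t => -[|t] /= ht; first by exists ord_max => //=; rewrite residueBn.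
  by exists (Ordinal (ltnW ht)).
have [tk|tk] := eqVneq (t : nat) k'.
  by exists ord0 => //=; rewrite residueBn // tk.
have ht : (t.+1 < k)%N by have := ltn_ord t; move: tk; lia.
by exists (Ordinal ht).
Qed.
End Index.

(** * A matrix with the Plucker coordinates as minors *)

Section Frame.
Variables (K : fieldType) (k' n' : nat).
Local Notation k := k'.+1.
Local Notation n := n'.+1.
Local Notation Gr := (Gr K k n).
Implicit Type s : nat -> nat.

Definition generic_mx : 'M[{mpoly K[k * n]}]_(k, n) :=
  \matrix_(a, j) generic_entry K a j.

Definition gdet (f : 'I_k -> 'I_n) : {mpoly K[k * n]} := \det (colsub f generic_mx).

Lemma plucker_polyE (I : {set 'I_n}) : #|I| = k ->
  plucker_poly K k I = gdet (fun b => nth ord0 (enum I) b).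
Proof.
move=> hI; rewrite /plucker_poly hI eqxx; congr (\det _); apply/matrixP => a b.
by rewrite !mxE (nth_map ord0) // -cardE hI.
Qed.

Lemma plucker_residues s : increasing k' s -> (s k' < n)%N ->
  plucker_poly K k (residues k' n' s) = gdet (fun b => residue n' (s b)).
Proof.
move=> hs hn; rewrite plucker_polyE ?card_residues // enum_residues //.
congr (\det _); apply/matrixP => a b; rewrite !mxE (nth_map 0%N) ?size_iota //.
by rewrite nth_iota.
Qed.

(** A minor with repeated columns is 0 and any other one is, up to sign, a
    Plucker coordinate. *)
Lemma gdet_in (f : 'I_k -> 'I_n) : gdet f \in genalg (@is_plucker K k n).
Proof.
have [/injectiveP fI|] := boolP (injectiveb f); last first.
  case/injectivePn => x [y nxy fxy].
  rewrite /gdet (@det_repeated_col _ _ _ x y) ?rpred0 // => a.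
  by rewrite !mxE fxy.
pose I := [set f x | x : 'I_k].
have hI : #|I| = k by rewrite card_imset // card_ord.
have hz : size (enum I) = k by rewrite -cardE.
have fin x : f x \in enum I by rewrite mem_enum; apply/imsetP; exists x.
have hr x : (index (f x) (enum I) < k)%N by rewrite -[X in (_ < X)%N]hz index_mem.
pose r x := Ordinal (hr x).
have rI : injective r.
  move=> x y [] h; apply: fI.
  by rewrite -(nth_index ord0 (fin x)) h nth_index.
rewrite /gdet (_ : colsub f generic_mx =
   col_perm (perm rI) (colsub (fun b => nth ord0 (enum I) b) generic_mx)); last first.
  by apply/matrixP => a b; rewrite !mxE permE /= nth_index.
rewrite col_permE det_mulmx det_perm -/(gdet _) -plucker_polyE // rpredM //.
  by apply/asboolP/in_alg_gen; exists I.
by rewrite -signr_odd; case: odd; rewrite ?rpredN rpred1.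
Qed.

(** The generic minor takes the value 1 at the matrix whose columns in [I] form
    the identity. *)
Lemma plucker_poly_neq0 (I : {set 'I_n}) : #|I| = k -> plucker_poly K k I != 0.
Proof.
move=> hI; rewrite plucker_polyE //; apply/eqP => h.
pose e (x : 'I_(k * n)) : K :=
  let: (a, j) := enum_val (cast_ord (esym (mxvec_cast k n)) x) in (nth ord0 (enum I) a == j)%:R.
have : (gdet (fun b => nth ord0 (enum I) b)).@[e] = 0 by rewrite h meval0.
rewrite /gdet -det_map_mx (_ : map_mx _ _ = 1%:M) ?det1 => [/eqP|].
  by rewrite oner_eq0.
apply/matrixP => a b; rewrite !mxE /generic_entry /= mevalXU /e /mxvec_index.
rewrite cast_ordK enum_rankK nth_uniq ?enum_uniq // -?cardE ?hI //.
Qed.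

Definition initial_minor : Gr := plucker K k (residues k' n' id).

(** The entries of [adj X0 * X], for [X] the generic matrix and [X0] its first
    [k] columns, given by Cramer's rule: they are minors of [X], so they lie in
    the homogeneous coordinate ring, contrary to those of [X]. *)
Definition frame_entry (a : 'I_k) (j : 'I_n) : Gr :=
  Subalg (gdet_in (fun t => if t == a then j else residue n' t)).

Definition frame_mx : 'M[Gr]_(k, n) := \matrix_(a, j) frame_entry a j.

(** So a ring morphism that sends the first coefficient to 1 takes the Plucker
    coordinates to the minors of an actual matrix, the image of [frame_mx]. *)
Lemma frame_det s : (k <= n)%N -> increasing k' s -> (s k' < n)%N ->
  \det (\matrix_(a < k, b < k) frame_mx a (residue n' (s b))) =
  initial_minor ^+ k' * plucker K k (residues k' n' s).
Proof.
move=> kn hs hn; apply/val_inj.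
rewrite -det_map_mx rmorphM rmorphXn /=.
have id_inc : increasing k' id by move=> a b /andP[].
rewrite !plucker_residues //.
set X0 := colsub (fun b : 'I_k => residue n' b) generic_mx.
pose S := colsub (fun b : 'I_k => residue n' (s b)) generic_mx.
have -> : map_mx (@subalg_val _ _ _) (\matrix_(a, b) frame_mx a (residue n' (s b))) =
    \adj X0 *m S.
  apply/matrixP => a b; rewrite !mxE /= /gdet.
  rewrite (_ : colsub _ _ = \matrix_(c, t < k)
     if t == a then generic_mx c (residue n' (s b)) else X0 c t); last first.
    by apply/matrixP => c t; rewrite !mxE; case: ifP.
  by rewrite det_replace_col; apply: eq_bigr => c _; rewrite !mxE mulrC.
rewrite det_mulmx -/(gdet _); congr (_ * _).
have d0 : \det X0 != 0.
  have := plucker_poly_neq0 (card_residues id_inc kn).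
  by rewrite plucker_residues.
apply: (mulIf d0); rewrite -det_mulmx mul_adj_mx det_scalar -exprSr //.
Qed.
End Frame.

(** * Periodic frames and the twist *)

Section PeriodicFrame.
Variables (K : fieldType) (k' n' : nat).
Local Notation k := k'.+1.
Local Notation n := n'.+1.
Local Notation Gr := (Gr K k n).
Local Notation plucker := (plucker K k).
Local Notation residues := (residues k' n').
Implicit Type s : nat -> nat.
Hypothesis kn : (k <= n)%N.

Section OneSpecialization.
Variables (F : fieldType) (phi : {rmorphism Gr -> F}).

(** The columns of the specialized matrix, extended to all indices with a sign
    per period that compensates for the rotation of [k] columns. *)
Definition frame (m : nat) : 'cV[F]_k :=
  ((-1) ^+ k') ^+ (m %/ n) *: \col_a phi (frame_mx K k' n' a (residue n' m)).

Lemma frame_periodic m : frame (m + n) = (-1) ^+ k' *: frame m.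
Proof.
rewrite /frame scalerA -exprS residueDn; congr (_ ^+ _ *: _).
by rewrite addnC -{1}[n]mul1n divnMDl.
Qed.

(** A rotation of [k] columns has sign [(-1)^(k-1)], which is also the sign
    gained by the column moved back by [n]. *)
Lemma minor_frame_rotate s : (n <= s k')%N ->
  minor frame (fun t => if t is t'.+1 then s t' else (s k' - n)%N) = minor frame s.
Proof.
move=> hn; set s' := fun t => _.
have := minor_perm frame s (lift_perm ord0 ord_max 1%g).
set A := \matrix_(a, b) _ => hA.
have : \det A = (-1) ^+ k' * minor frame s'.
  rewrite /minor !(expand_det_col _ ord0) mulr_sumr; apply: eq_bigr => a _.
  rewrite [A a ord0]mxE lift_perm_id [X in _ = _ * (X * _)]mxE.
  rewrite -[X in frame X](subnK hn) frame_periodic [X in X * _ = _]mxE -mulrA.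
  congr (_ * (_ * (_ * \det _))); apply/matrixP => c b; rewrite !mxE.
  rewrite lift_perm_lift perm1 (_ : s' _ = s (lift ord_max b)) //.
  by rewrite lift_max.
rewrite hA odd_lift_perm odd_perm1 addbF /= signr_odd => /(mulfI _) -> //.
by rewrite signr_eq0.
Qed.

Hypothesis phi_coef : forall i, phi (plucker (coef_set k i)) = 1.

Lemma phi_consecutive c : phi (plucker (residues (addn c))) = 1.
Proof. by rewrite -coef_residues phi_coef. Qed.

(** Rotate the last index to the front as long as it is at least [n]. *)
Lemma minor_frame s : increasing k' s -> (s k' < s 0%N + n)%N ->
  minor frame s = phi (plucker (residues s)).
Proof.
have [N] := ubnP (s k'); elim: N s => // N IH s hN hs hw.
have [hn|hn] := leqP n (s k').
  have s_last : (0 < k')%N -> (s k'.-1 < s k')%N by move=> h; apply: hs; lia.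
  have s_first b : (b < k')%N -> (s 0%N <= s b)%N.
    by case: b => // b hb; apply/ltnW/hs; lia.
  rewrite -minor_frame_rotate // -residues_rotate //; apply: IH.
  - by case: (k') s_last hN hn => [|k1] /= s_last hN hn; lia.
  - move=> [|a] [|b] //= h; last by apply: hs; lia.
    by have := s_first b h; lia.
  - by case: (k') s_last hN hn => [|k1] /= s_last hN hn; lia.
have id_inc : increasing k' id by move=> a b /andP[].
have sn b : (b < k)%N -> (s b < n)%N.
  rewrite ltnS leq_eqVlt => /orP[/eqP-> //|h]; apply: ltn_trans hn; apply: hs; lia.
have := congr1 phi (frame_det K kn hs hn).
rewrite -det_map_mx rmorphM rmorphXn /=.
rewrite (_ : phi (initial_minor _ _ _) = 1); last first.
  by rewrite -[RHS](phi_consecutive 0).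
rewrite expr1n mul1r => <-; congr (\det _); apply/matrixP => a b; rewrite !mxE.
by rewrite divn_small ?sn // mul1r.
Qed.

Lemma minor_frame_consecutive c : minor frame (addn c) = 1.
Proof.
by rewrite minor_frame ?phi_consecutive //; [move=> a b; lia | lia].
Qed.

Lemma minor_frame_skip m i j : (i <= k)%N -> (j + k <= n)%N ->
  minor frame (fun t => m + skip i j t)%N = phi (plucker (rho_set m (M_set k n i j))).
Proof.
move=> ik jk; rewrite M_residues // rho_residues; apply: minor_frame.
  by move=> a b h; rewrite /skip; do 2 case: ifP; lia.
by rewrite /skip; do 2 case: ifP; lia.
Qed.

Lemma phi_frozen m i : (i <= k)%N ->
  phi (plucker (rho_set m (M_set k n i (n - k)))) = 1.
Proof.
move=> ik; rewrite M_residues // ?subnK // skip_top_residues // rho_residues.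
rewrite -[RHS](phi_consecutive (m + (n - k + i))); congr (phi (plucker _)).
by apply: eq_residues => b _; rewrite addnA.
Qed.
End OneSpecialization.

Lemma periodic_ext (F : fieldType) (g : 'M[F]_k) (c : F) (v u : nat -> 'cV[F]_k) :
  (forall m, v (m + n)%N = c *: v m) -> (forall m, u (m + n)%N = c *: u m) ->
  (forall m, (m < n)%N -> u m = g *m v m) -> forall m, u m = g *m v m.
Proof.
move=> hv hu h; elim/ltn_ind => m IH; have [/h //|mn] := ltnP m n.
by rewrite -(subnK mn) hu hv IH ?scalemxAr //; lia.
Qed.

(** Here [phi1], [phi2], [phi3] stand for [pi], [gamma pi] and [gamma^2 pi]
    followed by the inclusion into the field of rational functions. *)
Section ThreeSpecializations.
Variables (F : fieldType) (phi1 phi2 phi3 : {rmorphism Gr -> F}).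
Hypothesis coef1 : forall i, phi1 (plucker (coef_set k i)) = 1.
Hypothesis coef2 : forall i, phi2 (plucker (coef_set k i)) = 1.
Hypothesis coef3 : forall i, phi3 (plucker (coef_set k i)) = 1.
Hypothesis twist12 : forall i j, (0 < i < k)%N -> (0 < j < n - k)%N ->
  phi2 (plucker (M_set k n i j)) = phi1 (plucker (rho_set i (M_set k n (k - i) j))).
Hypothesis twist23 : forall i j, (0 < i < k)%N -> (0 < j < n - k)%N ->
  phi3 (plucker (M_set k n i j)) = phi2 (plucker (rho_set i (M_set k n (k - i) j))).
Hypothesis nz2 : forall i j, (0 < i < k)%N -> (0 < j < n - k)%N ->
  phi2 (plucker (M_set k n i j)) != 0.
Hypothesis nz3 : forall i j, (0 < i < k)%N -> (0 < j < n - k)%N ->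
  phi3 (plucker (M_set k n i j)) != 0.

Lemma minor_frame_M (phi : {rmorphism Gr -> F}) i j :
  (forall i, phi (plucker (coef_set k i)) = 1) -> (i <= k)%N -> (j + k <= n)%N ->
  minor (frame phi) (skip i j) = phi (plucker (M_set k n i j)).
Proof. by move=> h ik jk; rewrite -(rho_set0 (M_set k n i j)) -minor_frame_skip. Qed.

(** Each of the two runs is replaced by the complementary end of the length-[k]
    interval starting with it; the result is again of the form [rho^m M]. *)
Lemma minor_twist_frame c i j : (i <= k)%N -> (j + k <= n)%N ->
  minor (twist (frame phi1)) (fun t => c + skip i j t)%N =
  phi1 (plucker (rho_set (c + i) (M_set k n (k - i) j))).
Proof.
move=> ik jk; rewrite -minor_frame_skip //; last by lia.
rewrite (@eq_minor _ _ _ (twist (frame phi1)) _ (two_runs c i (c + i + j))) => [|b hb].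
  rewrite (@twist_two_runs _ _ _ _ i (k - i)); [|exact: minor_frame_consecutive|lia].
  by apply: eq_minor => b hb; congr frame; rewrite /two_runs /skip; case: ifP; lia.
by congr twist; rewrite /two_runs /skip; case: ifP; lia.
Qed.

(** [gamma] is the twist: the twisted frame of [phi1] and the frame of [phi2]
    have the same minors on the initial seed, by [minor_twist_frame] for the
    mutable vertices, while both give 1 on the frozen ones. Hence they differ by
    a matrix of determinant 1. *)
Lemma frame2_twist : exists g : 'M[F]_k,
  \det g = 1 /\ forall m, frame phi2 m = g *m twist (frame phi1) m.
Proof.
have tw c : minor (twist (frame phi1)) (addn c) = 1.
  by apply: twist_consecutive; apply: minor_frame_consecutive.
have f2 c : minor (frame phi2) (addn c) = 1 by apply: minor_frame_consecutive.
have [|||i j ik jk|g [dg hg]] := @minors_determine _ _ n (twist (frame phi1)) (frame phi2).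
- exact: kn.
- by rewrite (tw 0%N) (f2 0%N).
- by rewrite (f2 0%N) oner_neq0.
- have [->|i0] := posnP i.
    by rewrite !minor_skip0 tw f2 oner_neq0.
  rewrite -[skip i j]/(fun t => 0 + skip i j t)%N minor_twist_frame; [|lia..].
  rewrite (minor_frame_M coef2); [|lia..].
  have [->|jn] := eqVneq j (n - k)%N.
    rewrite -(rho_set0 (M_set k n i _)) !phi_frozen ?oner_neq0 //; lia.
  by rewrite add0n twist12 -?twist12 ?nz2 //; lia.
- exists g; split=> //; apply: (@periodic_ext _ _ ((-1) ^+ k')) => // m.
    by apply: twist_periodic => ?; apply: frame_periodic.
  exact: frame_periodic.
Qed.

(** On the initial seed [phi3] is computed by minors of the frame of [phi2],
    hence by minors of the twisted frame of [phi1]; twisting a second time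
    leaves those of the frame of [phi1] translated by [k]. *)
Lemma phi3_shift (I : {set 'I_n}) : #|I| = k ->
  phi3 (plucker I) = phi1 (plucker (rho_set k I)).
Proof.
have [g [dg hg]] := frame2_twist.
have m2 s : minor (frame phi2) s = minor (twist (frame phi1)) s.
  by rewrite -[RHS]mul1r -dg -minor_mull; apply: eq_minor => b _; apply: hg.
(* The frame of [phi1 \o rho^k]. *)
pose w m := frame phi1 (k + m).
have mw s : minor w s = minor (frame phi1) (fun t => k + s t)%N by [].
have f3 c : minor (frame phi3) (addn c) = 1 by apply: minor_frame_consecutive.
have wc c : minor w (addn c) = 1.
  rewrite mw -[RHS](minor_frame_consecutive coef1 (k + c)); apply: eq_minor => b _.
  by rewrite addnA.
have [|||i j ik jk|h [dh hh]] := @minors_determine _ _ n w (frame phi3).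
- exact: kn.
- by rewrite (wc 0%N) (f3 0%N).
- by rewrite (f3 0%N) oner_neq0.
- have [->|i0] := posnP i.
    by rewrite !minor_skip0 wc f3 oner_neq0.
  rewrite mw minor_frame_skip //; [|lia..].
  rewrite (minor_frame_M coef3); [|lia..].
  have [->|jn] := eqVneq j (n - k)%N.
    rewrite -(rho_set0 (M_set k n i (n - k))) phi_frozen ?oner_neq0; [|by []|lia].
    by rewrite rho_set0 phi_frozen //; lia.
  rewrite nz3 ?twist23; [|lia..]; split=> //.
  rewrite -(minor_frame_skip coef2); [|lia..].
  rewrite m2 minor_twist_frame; [|lia..].
  by rewrite subnKC ?subKn //; lia.
move=> /residuesP[s [hs hn ->]]; rewrite rho_residues -(minor_frame coef3 hs) ?ltn_addl //.
rewrite -(minor_frame coef1); [|by move=> a b /hs; rewrite ltn_add2l|lia].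
rewrite -mw -[RHS]mul1r -dh -minor_mull; apply: eq_minor => b hb; apply: hh.
rewrite ltnS in hb; move: hb; rewrite leq_eqVlt => /orP[/eqP-> //|hb].
by apply: ltn_trans hn; apply: hs; lia.
Qed.
End ThreeSpecializations.
End PeriodicFrame.

(** * Morphisms from the coordinate ring *)

Lemma Gr_ext (K : fieldType) k n (S : lalgType K) (f g : {lrmorphism Gr K k n -> S}) :
  (forall I : {set 'I_n}, #|I| = k -> f (plucker K k I) = g (plucker K k I)) ->
  f =1 g.
Proof.
move=> h x; case: x (erefl (subalg_val x)) => p hp _.
move/asboolP: (hp) => hin; elim: hin hp => {p} [p [I [hI ->]]|c|p q hp IHp hq IHq|p q hp IHp hq IHq] hx.
- have -> : Subalg hx = plucker K k I by apply/val_inj.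
  exact: h.
- have -> : Subalg hx = c%:A by apply/val_inj.
  by rewrite !linearZ /= !rmorph1.
- have hp' : p \in genalg (@is_plucker K k n) by apply/asboolP.
  have hq' : q \in genalg (@is_plucker K k n) by apply/asboolP.
  have -> : Subalg hx = Subalg hp' + Subalg hq' by apply/val_inj.
  by rewrite !rmorphD; congr (_ + _); [apply: IHp | apply: IHq].
- have hp' : p \in genalg (@is_plucker K k n) by apply/asboolP.
  have hq' : q \in genalg (@is_plucker K k n) by apply/asboolP.
  have -> : Subalg hx = Subalg hp' * Subalg hq' by apply/val_inj.
  by rewrite !rmorphM; congr (_ * _); [apply: IHp | apply: IHq].
Qed.

Lemma lrmorphism_can (K : fieldType) (A B : algType K) (f : {lrmorphism A -> B})
    (g : B -> A) : cancel f g -> cancel g f ->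
  exists h : {lrmorphism B -> A}, h =1 g.
Proof.
move=> fK gK.
have gB := can2_zmod_morphism fK gK.
have gM := can2_monoid_morphism fK gK.
have gZ : scalable g by move=> c x; apply: (canLR fK); rewrite linearZ /= gK.
pose gz := GRing.isZmodMorphism.Build B A g gB.
pose gm := GRing.isMonoidMorphism.Build B A g gM.
pose gs := GRing.isScalable.Build K B A *:%R g gZ.
pose h : {lrmorphism B -> A} := HB.pack g gz gm gs.
by exists h.
Qed.

Lemma lrmorphism_iter (K : fieldType) (A : algType K) (f : {lrmorphism A -> A}) m :
  exists h : {lrmorphism A -> A}, h =1 iter m f.
Proof.
elim: m => [|m [h hE]]; first by exists idfun.
by exists (f \o h) => x /=; rewrite hE.
Qed.

Lemma card_M (k' n' i j : nat) : (i <= k'.+1)%N -> (j + k'.+1 <= n'.+1)%N ->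
  #|M_set k'.+1 n'.+1 i j| = k'.+1.
Proof.
move=> ik jk; rewrite M_residues // card_residues //.
  by move=> a b h; rewrite /skip; do 2 case: ifP; lia.
by rewrite /skip; case: ifP; lia.
Qed.

(** * The square of gamma *)

Theorem corollary11p11 (R : realType) (k n : nat)
    (hk : (3 <= k)%N) (hkn : (k <= n - 3)%N)
    (sigma : {lrmorphism Gr R[i] k n -> Gr R[i] k n})
    (sigmaV : Gr R[i] k n -> Gr R[i] k n)
    (pi : {lrmorphism Gr R[i] k n -> Gr1 R[i] k n})
    (gamma : {lrmorphism Gr1 R[i] k n -> Gr1 R[i] k n})
    (hsigma : is_sigma sigma)
    (hsigmaV : cancel sigma sigmaV /\ cancel sigmaV sigma)
    (hpi : is_pi pi)
    (hgamma : is_gamma pi gamma) :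
  forall f : Gr R[i] k n, gamma (gamma (pi f)) = pi (iter k sigmaV f).
Proof.
case: k hk hkn sigma sigmaV pi gamma hsigma hsigmaV hpi hgamma => // k' hk.
case: n => [|n'] hkn sigma sigmaV pi gamma; first by exfalso; lia.
move=> [_ sigmaE] [sigmaK sigmaVK] [_ pi_coef pi_M] [[gamma' gammaK _] gammaE].
have plucker_shift (I : {set 'I_n'.+1}) : #|I| = k'.+1 ->
    gamma (gamma (pi (plucker R[i] k'.+1 I))) = pi (plucker R[i] k'.+1 (rho_set k'.+1 I)).
  move=> hI; apply/val_inj.
  have kn : (k'.+1 <= n'.+1)%N by lia.
  have M_card i j : (0 < i < k'.+1)%N -> (0 < j < n'.+1 - k'.+1)%N ->
      #|M_set k'.+1 n'.+1 i j| = k'.+1.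
    by move=> hi hj; apply: card_M; lia.
  have pi_neq0 i j : (0 < i < k'.+1)%N -> (0 < j < n'.+1 - k'.+1)%N ->
      pi (plucker R[i] k'.+1 (M_set k'.+1 n'.+1 i j)) != 0.
    move=> hi hj; rewrite -(inj_eq val_inj) /= pi_M; [|lia..].
    by rewrite tofrac_eq0 plucker_poly_neq0 ?M_card.
  have gamma_neq0 x : x != 0 -> gamma x != 0.
    by rewrite -(inj_eq (can_inj gammaK)) rmorph0.
  have twistE i j : (0 < i < k'.+1)%N -> (0 < j < n'.+1 - k'.+1)%N ->
      gamma (pi (plucker R[i] k'.+1 (M_set k'.+1 n'.+1 i j))) =
      pi (plucker R[i] k'.+1 (rho_set i (M_set k'.+1 n'.+1 (k'.+1 - i) j))).
    move=> hi hj; rewrite gammaE; [|lia..].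
    by rewrite /Mtilde_set subKn //; lia.
  pose F : fieldType := ratfun R[i] (k'.+1 * n'.+1).
  pose val1 : {rmorphism Gr1 R[i] k'.+1 n'.+1 -> F} :=
    (val : Gr1 R[i] k'.+1 n'.+1 -> _).
  have val1_neq0 x : (val1 x != 0) = (x != 0).
    by rewrite -[0]/(val (0 : Gr1 _ _ _)) (inj_eq val_inj).
  have := @phi3_shift R[i] k' n' kn F (val1 \o pi)
    (val1 \o (gamma \o pi)) (val1 \o (gamma \o (gamma \o pi))).
  apply; last exact: hI; move=> i /=.
  - by rewrite pi_coef.
  - by rewrite pi_coef rmorph1.
  - by rewrite pi_coef !rmorph1.
  - by move=> j hi hj; rewrite twistE.
  - by move=> j hi hj; rewrite twistE.
  - by move=> j hi hj; rewrite val1_neq0 gamma_neq0 ?pi_neq0.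
  - by move=> j hi hj; rewrite val1_neq0 !gamma_neq0 ?pi_neq0.
have [tau tauE] := lrmorphism_can sigmaK sigmaVK.
have tau_plucker m (I : {set 'I_n'.+1}) : #|I| = k'.+1 ->
    iter m tau (plucker R[i] k'.+1 I) = plucker R[i] k'.+1 (rho_set m I).
  move=> hI; elim: m => [|m IH]; first by rewrite rho_set0.
  rewrite iterS IH rho_setS tauE -[in LHS](sigma_rho (rho_set m I)) -sigmaE ?sigmaK //.
  by rewrite !card_rho.
have [h hE] := lrmorphism_iter tau k'.+1.
move=> f; rewrite -(eq_iter tauE) -hE.
apply: (@Gr_ext _ _ _ _ (gamma \o (gamma \o pi)) (pi \o h)) => I hI.
by rewrite /= plucker_shift // hE tau_plucker.
Qed.
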